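(* Consider the optimal control problem $$\min_{(q,u)}\int_0^T C(q,\dot q,u)\,dt\quad\text{subject to}\quad\ddot q=f(q,\dot q,u),\quad (q,\dot q)(0)=(q_0,v_0),\quad (q,\dot q)(T)=(q_T,v_T),$$ and a normal extremal $(x(\cdot),\lambda(\cdot))$ of it, $x=(q,v)$, $\lambda=(\lambda_q,\lambda_v)$, along which the strong Legendre condition holds. Let $y=(q,\kappa)$, with $\kappa=\lambda_v$, be the corresponding solution of the Euler--Lagrange equation of the new Lagrangian $\tilde{\mathcal L}(y,\dot y)$. (All objects are defined in the context.) Then the conjugate times obtained from the linearised reduced Hamiltonian system $$\delta\dot x=\frac{\partial^2\mathcal H^r}{\partial x\,\partial\lambda}\delta x+\frac{\partial^2\mathcal H^r}{\partial\lambda^2}\delta\lambda,\qquad \delta\dot\lambda=-\frac{\partial^2\mathcal H^r}{\partial x^2}\delta x-\frac{\partial^2\mathcal H^r}{\partial x\,\partial\lambda}\delta\lambda$$ along $(x,\lambda)$ and the conjugate times obtained from the linearised Euler--Lagrange (Jacobi) equation $$\left(\frac{\partial^2\tilde{\mathcal L}}{\partial y^2}-\frac{d}{dt}\frac{\partial^2\tilde{\mathcal L}}{\partial y\,\partial\dot y}\right)\delta y-\frac{d}{dt}\left(\frac{\partial^2\tilde{\mathcal L}}{\partial\dot y^2}\,\delta\dot y\right)=0$$ along $y$ coincide.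
   Context: Setting. $\mathcal Q$ is a smooth $n$-dimensional configuration manifold; everything is written in local coordinates, with $q,v\in\mathbb R^n$ and the control $u$ in a vector space (no control constraints). The cost $C(q,v,u)\in\mathbb R$ and the vector field $f(q,v,u)\in\mathbb R^n$ are of class $C^2$. On the Lagrangian side $q,\kappa$ are of class $C^2$ and $u$ is continuous. Hamiltonian side. The state is $x=(q,v)$ with $v=\dot q$. The normal (abnormal multiplier $\lambda^0=-1$) Pontryagin Hamiltonian is $$\mathcal H(x,\lambda,u)=\lambda_q^\top v+\lambda_v^\top f(q,v,u)-C(q,v,u).$$ The strong Legendre condition is that $\partial^2\mathcal H/\partial u^2$ is negative definite along the extremal for all $t\in[0,T]$. Under it, $\partial\mathcal H/\partial u=0$ can be solved, by the implicit function theorem, for the optimal control as a function $u^*(x,\lambda)$, and the reduced Hamiltonian is $\mathcal H^r(x,\lambda)=\mathcal H(x,\lambda,u^*(x,\lambda))$. A (normal) extremal is a solution on $[0,T]$ of $\dot x=\partial\mathcal H^r/\partial\lambda$, $\dot\lambda=-\partial\mathcal H^r/\partial x$ satisfying the boundary conditions $x(0)=(q_0,v_0)$, $x(T)=(q_T,v_T)$. It is assumed to have corank 1: the vector space spanned by the values $(\lambda(T),\lambda^0)$ of all multipliers that satisfy the Pontryagin equations with the given $(x,u)$ has dimension 1. In the linearised system the second derivatives of $\mathcal H^r$ are evaluated along the extremal, and the mixed-derivative matrix in the second equation is understood as the transpose of the one in the first, so that the system is the linearisation of the Hamiltonian system. Lagrangian side. The new control Lagrangian is $$\tilde{\mathcal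 L}^{\mathcal E}(q,\kappa,v_q,v_\kappa,u)=v_\kappa^\top v_q+\kappa^\top f(q,v_q,u)-C(q,v_q,u).$$ With $y=(q,\kappa)$ and $\dot y=(v_q,v_\kappa)$, the condition $\partial^2\tilde{\mathcal L}^{\mathcal E}/\partial u^2<0$ (equivalent to the strong Legendre condition) allows the optimal control to be written as $u=u(y,\dot y)$ (solving $\partial\tilde{\mathcal L}^{\mathcal E}/\partial u=0$), and the new Lagrangian is $\tilde{\mathcal L}(y,\dot y)=\tilde{\mathcal L}^{\mathcal E}(y,\dot y,u(y,\dot y))$. Its Euler--Lagrange equation is $\frac{\partial\tilde{\mathcal L}}{\partial y}-\frac{d}{dt}\frac{\partial\tilde{\mathcal L}}{\partial\dot y}=0$. In the Jacobi equation the second derivatives of $\tilde{\mathcal L}$ are evaluated along $(y(t),\dot y(t))$, $\frac{\partial^2\tilde{\mathcal L}}{\partial y\,\partial\dot y}$ is the matrix of mixed second derivatives of $\tilde{\mathcal L}$ in $y$ and $\dot y$, and $\delta y=(\delta q,\delta\kappa)$. Conjugate times. For either linear equation, a conjugate time is a time $t_c>0$ for which there is a nontrivial (not identically zero) solution satisfying $\delta x(0)=0$ and $\delta x(t_c)=0$, where in the Lagrangian case $\delta x=(\delta q,\delta\dot q)$.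
   Formalization: The displayed Jacobi equation is replaced by the true linearised Euler–Lagrange equation d/dt(L_{ẏy}δy + L_{ẏẏ}δẏ) = L_{yy}δy + L_{yẏ}δẏ; the two agree if L_{yẏ} is symmetric and differentiable in t, and the claim fails for the display otherwise (f=u+av, C=(u²−wq²)/2). *)

(* Defs.v *)
From HB Require Import structures.
From mathcomp Require Import all_boot all_order all_algebra.
From mathcomp Require Import all_classical all_reals all_analysis.
Set Implicit Arguments.
Unset Strict Implicit.
Unset Printing Implicit Defensive.
Import Order.TTheory GRing.Theory Num.Theory.
Import numFieldNormedType.Exports.
Local Open Scope classical_set_scope.
Local Open Scope ring_scope.

Section Calculus.
Context {R : realType}.

(* Class C^k on a set U, meant for U open in a finite-dimensional space: there,
   continuity of all directional derivatives is continuity of the differential. *)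
Fixpoint class_C (k : nat) (V W : normedModType R) (U : set V) (g : V -> W)
    : Prop :=
  if k is k'.+1 then
    (forall p, U p -> differentiable g p) /\
    (forall v, class_C k' U (fun p => 'D_v g p))
  else forall p, U p -> {for p, continuous g}.

(* g has derivative d at t relative to [0, T]; one-sided at the end points. *)
Definition deriv_on (T : R) (V : normedModType R) (g : R -> V) (t : R) (d : V) :=
  (s - t)^-1 *: (g s - g t) @[s --> within `[0, T] t^'] --> d.

Definition dotp (k : nat) (a b : 'cV[R]_k) : R := (a^T *m b) 0 0.

Definition grad (k : nat) (F : 'cV[R]_k -> R) (z : 'cV[R]_k) : 'cV[R]_k :=
  \col_i 'D_(delta_mx i 0) F z.

Definition hess (k : nat) (F : 'cV[R]_k -> R) (z : 'cV[R]_k) : 'M[R]_k :=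
  \matrix_(i, j) 'D_(delta_mx j 0) (fun w => grad F w i 0) z.

(* Entry (i, j) is d^2 F / (d a_i d b_j). *)
Definition mixed_hess (k p : nat) (F : 'cV[R]_k -> 'cV[R]_p -> R)
    (a : 'cV[R]_k) (b : 'cV[R]_p) : 'M[R]_(k, p) :=
  \matrix_(i, j) 'D_(delta_mx j 0) (fun w => grad (F ^~ w) a i 0) b.

Definition negative_definite (k : nat) (A : 'M[R]_k) :=
  forall z : 'cV[R]_k, z != 0 -> dotp z (A *m z) < 0.

(* w is a C^1 solution, on the open set U, of dF/du (a, b, w(a, b)) = 0, as
   provided by the implicit function theorem. *)
Definition critical_control (k p m : nat)
    (F : 'cV[R]_k -> 'cV[R]_p -> 'cV[R]_m -> R)
    (U : set ('cV[R]_k * 'cV[R]_p)%type)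
    (w : 'cV[R]_k -> 'cV[R]_p -> 'cV[R]_m) :=
  [/\ open U,
      class_C 1 U (fun z : ('cV[R]_k * 'cV[R]_p)%type => w z.1 z.2) &
      forall a b, U (a, b) -> grad (F a b) (w a b) = 0].

Definition reduced (k p m : nat)
    (F : 'cV[R]_k -> 'cV[R]_p -> 'cV[R]_m -> R)
    (w : 'cV[R]_k -> 'cV[R]_p -> 'cV[R]_m) :
    'cV[R]_k -> 'cV[R]_p -> R :=
  fun a b => F a b (w a b).

End Calculus.

Section Control.
Context {R : realType} {n m : nat}.
Variable f : 'cV[R]_n -> 'cV[R]_n -> 'cV[R]_m -> 'cV[R]_n.
Variable C : 'cV[R]_n -> 'cV[R]_n -> 'cV[R]_m -> R.

(* x = col_mx q v and l = col_mx l_q l_v *)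
Definition pontryagin_ham (l0 : R) (x l : 'cV[R]_(n + n)) (u : 'cV[R]_m) : R :=
  dotp (usubmx l) (dsubmx x)
  + dotp (dsubmx l) (f (usubmx x) (dsubmx x) u)
  + l0 * C (usubmx x) (dsubmx x) u.

Definition normal_ham := pontryagin_ham (-1).

(* y = col_mx q kappa and yd = col_mx v_q v_kappa *)
Definition control_lagrangian (y yd : 'cV[R]_(n + n)) (u : 'cV[R]_m) : R :=
  dotp (dsubmx yd) (usubmx yd)
  + dotp (dsubmx y) (f (usubmx y) (usubmx yd) u)
  - C (usubmx y) (usubmx yd) u.

(* (l, l0) is a multiplier of the control trajectory (x, u). No sign is imposed
   on l0: the equations are linear in (l, l0), so requiring l0 <= 0 would not
   change the span in corank1. *)
Definition multiplier (T : R) (x : R -> 'cV[R]_(n + n)) (u : R -> 'cV[R]_m)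
    (l : R -> 'cV[R]_(n + n)) (l0 : R) :=
  forall t, 0 <= t <= T ->
    [/\ deriv_on T x t (grad (fun p => pontryagin_ham l0 (x t) p (u t)) (l t)),
        deriv_on T l t (- grad (fun z => pontryagin_ham l0 z (l t) (u t)) (x t)) &
        grad (pontryagin_ham l0 (x t) (l t)) (u t) = 0].

Definition is_span (K : fieldType) (E : vectType K) (S : set E) (W : {vspace E}) :=
  (forall e, S e -> e \in W) /\
  (forall W' : {vspace E}, (forall e, S e -> e \in W') -> (W <= W')%VS).

Definition corank1 (T : R) (x : R -> 'cV[R]_(n + n)) (u : R -> 'cV[R]_m) :=
  exists W : {vspace 'cV[R]_(n + n + 1)},
    is_span [set e | exists l l0,
               multiplier T x u l l0 /\ e = col_mx (l T) (l0%:M)] W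
    /\ \dim W = 1%N.

Definition strong_legendre (T : R) (x l : R -> 'cV[R]_(n + n))
    (u : R -> 'cV[R]_m) :=
  forall t, 0 <= t <= T -> negative_definite (hess (normal_ham (x t) (l t)) (u t)).

End Control.

Section Flows.
Context {R : realType} {n : nat}.
Local Notation V := 'cV[R]_(n + n).

Definition hamiltonian_solution (Hr : V -> V -> R) (T : R) (x l : R -> V) :=
  forall t, 0 <= t <= T ->
    deriv_on T x t (grad (Hr (x t)) (l t)) /\
    deriv_on T l t (- grad (Hr ^~ (l t)) (x t)).

(* mixed_hess Hr has rows indexed by x and columns by l. *)
Definition linearised_hamiltonian_solution (Hr : V -> V -> R) (T : R)
    (x l dx dl : R -> V) :=
  forall t, 0 <= t <= T ->
    deriv_on T dx t ((mixed_hess Hr (x t) (l t))^T *m dx t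
                     + hess (Hr (x t)) (l t) *m dl t) /\
    deriv_on T dl t (- (hess (Hr ^~ (l t)) (x t) *m dx t)
                     - mixed_hess Hr (x t) (l t) *m dl t).

Definition hamiltonian_conjugate_time (Hr : V -> V -> R) (T : R)
    (x l : R -> V) (tc : R) :=
  0 < tc <= T /\
  exists dx dl : R -> V,
    [/\ linearised_hamiltonian_solution Hr T x l dx dl,
        exists2 t, 0 <= t <= T & (dx t, dl t) != (0, 0),
        dx 0 = 0 & dx tc = 0].

Definition euler_lagrange_solution (L : V -> V -> R) (T : R) (y yd : R -> V) :=
  forall t, 0 <= t <= T ->
    deriv_on T y t (yd t) /\
    deriv_on T (fun s => grad (L (y s)) (yd s)) t (grad (L ^~ (yd t)) (y t)).

(* Linearisation of the Euler-Lagrange equation along y: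
     d/dt (L_{yd y} dy + L_{yd yd} dyd) = L_{yy} dy + L_{y yd} dyd
   with L_{yd y} = (L_{y yd})^T. If L_{y yd} is symmetric and differentiable in
   t, this is (L_{yy} - d/dt L_{y yd}) dy - d/dt (L_{yd yd} dyd) = 0. The mixed
   matrix of the Lagrangian of interest is not symmetric in general, and is only
   continuous in t, so the term (L_{y yd} - L_{yd y}) dyd is kept and the
   momentum is differentiated as a whole. *)
Definition jacobi_solution (L : V -> V -> R) (T : R) (y yd dy dyd : R -> V) :=
  forall t, 0 <= t <= T ->
    deriv_on T dy t (dyd t) /\
    deriv_on T (fun s => (mixed_hess L (y s) (yd s))^T *m dy s
                         + hess (L (y s)) (yd s) *m dyd s) t
      (hess (L ^~ (yd t)) (y t) *m dy t + mixed_hess L (y t) (yd t) *m dyd t).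

(* The vanishing condition bears on (dq, d/dt dq), the q-blocks of dy and dyd. *)
Definition lagrangian_conjugate_time (L : V -> V -> R) (T : R)
    (y yd : R -> V) (tc : R) :=
  0 < tc <= T /\
  exists dy dyd : R -> V,
    [/\ jacobi_solution L T y yd dy dyd,
        exists2 t, 0 <= t <= T & dy t != 0,
        (usubmx (dy 0), usubmx (dyd 0)) = (0, 0) &
        (usubmx (dy tc), usubmx (dyd tc)) = (0, 0)].

End Flows.

(* Main.v *)
Require Import Defs.
From HB Require Import structures.
From mathcomp Require Import all_boot all_order all_algebra.
From mathcomp Require Import all_classical all_reals all_analysis.
From mathcomp Require Import ring.
Import Order.TTheory GRing.Theory Num.Theory.
Import numFieldNormedType.Exports.
Set Implicit Arguments.
Unset Strict Implicit.
Unset Printing Implicit Defensive.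
Local Open Scope classical_set_scope.
Local Open Scope ring_scope.

(** Let g(q, v, k, u) = k^T f(q, v, u) - C(q, v, u). The Hamiltonian is
    l_q^T v + g(q, v, l_v, u) and the control Lagrangian is
    v_k^T v_q + g(q, v_q, k, u): a bilinear form plus the same function at the
    same point. Differentiating dg/du = 0 along either control law and using
    that g_uu is negative definite, both laws have the same sensitivity
    z |-> s(z) to z = (q, v, k), so the second derivatives of both reduced
    functions are those of the bilinear form plus one symmetric form
    (z, z') |-> g''((z, s z), (z', s z')). With A_qq, A_qv, ... the blocks of
    this form, the Jacobi momentum conjugate to q is
    P = A_vq dq + A_vk dk + A_vv dv + dk', the one conjugate to k is dv, and the
    linearised Hamiltonian system is the Jacobi equation under
    dl_v = dk, dl_q = - P. *)

(** * Directional derivatives and the symmetry of second derivatives *)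

Section DirectionalDerivatives.
Context {R : realType}.
Implicit Types V W X : normedModType R.

(** A directional derivative sees a function only along a line, so it can be carried between
    different spaces without any differentiability. *)
Lemma eq_quotient_derive V W X (f : V -> X) (g : W -> X) p v q w :
  (forall h : R, f (h *: v + p) = g (h *: w + q)) -> 'D_v f p = 'D_w g q.
Proof.
move=> fg; have fg0 : f p = g q by have := fg 0; rewrite !scale0r !add0r.
rewrite /derive.
have -> : (fun h : R => h^-1 *: ((f \o shift p) (h *: v) - f p)) =
          (fun h : R => h^-1 *: ((g \o shift q) (h *: w) - g q)).
  by apply/funext => h /=; rewrite fg fg0.
by [].
Qed.

Lemma derive_comp_lin V W X (g : W -> X) (A : {linear V -> W}) (v p : V) :
  'D_v (fun z => g (A z)) p = 'D_(A v) g (A p).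
Proof. by apply: eq_quotient_derive => h; rewrite linearP. Qed.

Lemma derive_slice1 V W X (g : V * W -> X) a b e :
  'D_e (fun z => g (z, b)) a = 'D_(e, 0) g (a, b).
Proof.
apply: eq_quotient_derive => h.
by congr (g (_, _)); rewrite /= scaler0 add0r.
Qed.

Lemma derive_slice2 V W X (g : V * W -> X) a b e :
  'D_e (fun z => g (a, z)) b = 'D_(0, e) g (a, b).
Proof.
apply: eq_quotient_derive => h.
by congr (g (_, _)); rewrite /= scaler0 add0r.
Qed.

Lemma deriveDdir V W (g : V -> W) p u v : differentiable g p ->
  'D_(u + v) g p = 'D_u g p + 'D_v g p.
Proof. by move=> dg; rewrite !deriveE// linearD. Qed.

(** Turns a directional derivative into an ordinary one, to which the mean value theorem applies. *)
Lemma derive_line V W (g : V -> W) (a p : V) (s : R) :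
  derivable g (s *: a + p) a ->
  is_derive s 1 (fun r : R => g (r *: a + p)) ('D_a g (s *: a + p)).
Proof.
have E : (fun h : R =>
    h^-1 *: ((fun r : R => g (r *: a + p)) (h *: 1 + s) - g (s *: a + p)))
  = (fun h : R => h^-1 *: (g (h *: a + (s *: a + p)) - g (s *: a + p))).
  by apply/funext => h; rewrite /= scalerDl addrA [h *: 1]mulr1.
by move=> dg; split; rewrite /derivable /derive E.
Qed.

Lemma derive_comp V W X (g : W -> X) (k : V -> W) (p e : V) :
  differentiable k p -> differentiable g (k p) ->
  'D_e (fun z => g (k z)) p = 'D_('D_e k p) g (k p).
Proof.
move=> dk dg; rewrite !deriveE//; last exact: differentiable_comp.
by rewrite (diff_comp dk dg).
Qed.

Lemma derive_pair V W X (f : V -> W) (g : V -> X) p e :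
  differentiable f p -> differentiable g p ->
  'D_e (fun z => (f z, g z)) p = ('D_e f p, 'D_e g p).
Proof.
move=> df dg; rewrite !deriveE//; last exact: differentiable_pair.
by rewrite diff_pair.
Qed.

Lemma class_C2_diff V W (g : V -> W) : class_C 2 setT g ->
  forall p, differentiable g p.
Proof. by case=> h _ p; exact: h. Qed.

Lemma class_C2_diff2 V W (g : V -> W) : class_C 2 setT g ->
  forall v p, differentiable ('D_v g) p.
Proof. by case=> _ h v p; case: (h v) => h' _; exact: h'. Qed.

(** The mean value theorem is applied twice: to [r |-> g (r a + h b + p) - g (r a + p)], whose
    increment is the second difference, then to ['D_a g] along [b]. *)
Lemma second_difference V (g : V -> R) (a b p : V) (h : R) :
  class_C 2 setT g -> 0 < h ->
  exists s t, [/\ 0 < s < h, 0 < t < h &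
   g (h *: a + (h *: b + p)) - g (h *: a + p) - (g (h *: b + p) - g p)
   = h * h * 'D_b ('D_a g) (s *: a + (t *: b + p))].
Proof.
move=> Cg h0.
have d1 := class_C2_diff Cg; have d2 := class_C2_diff2 Cg.
have line v (k : V -> R) (q : V) (s : R) : (forall z, differentiable k z) ->
  is_derive s 1 (fun r : R => k (r *: v + q)) ('D_v k (s *: v + q)).
  by move=> dk; apply: derive_line; exact: diff_derivable.
have dphi (s : R) : is_derive s 1
    (fun r : R => g (r *: a + (h *: b + p)) - g (r *: a + p))
    ('D_a g (s *: a + (h *: b + p)) - 'D_a g (s *: a + p)).
  exact: is_deriveB (line _ _ _ _ d1) (line _ _ _ _ d1).
have cont (k dk : R -> R) : (forall s : R, is_derive s 1 k (dk s)) ->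
    {within `[0, h], continuous k}.
  move=> dk'; apply: continuous_subspaceT => s.
  apply: differentiable_continuous; apply/derivable1_diffP.
  by case: (dk' s).
have [s sh es] := MVT h0 (fun s _ => dphi s) (cont _ _ dphi).
have dpsi (t : R) : is_derive t 1
    (fun r : R => 'D_a g (r *: b + (s *: a + p)))
    ('D_b ('D_a g) (t *: b + (s *: a + p))).
  exact: line (d2 a).
have [t th et] := MVT h0 (fun t _ => dpsi t) (cont _ _ dpsi).
exists s, t; split; [by move: sh; rewrite in_itv|by move: th; rewrite in_itv|].
move: es et; rewrite !scale0r !add0r !subr0 => es.
rewrite [h *: b + (s *: a + p)]addrCA [t *: b + (s *: a + p)]addrCA => et.
by rewrite es et -mulrA mulrC.
Qed.

(* Both mixed derivatives are limits of the same symmetric second difference. *)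
Lemma derive_symm V (g : V -> R) (a b p : V) : class_C 2 setT g ->
  'D_a ('D_b g) p = 'D_b ('D_a g) p.
Proof.
move=> Cg; apply/eqP; rewrite -subr_eq0 -normr_le0; apply/ler_addgt0Pr => e e0.
have cont u v : {for p, continuous ('D_u ('D_v g))}.
  by case: Cg => _ /(_ v)[_ /(_ u)]; apply.
rewrite add0r.
have e2 : 0 < e / 2 by rewrite divr_gt0.
have [d d0 hd] : exists2 d : R, 0 < d & forall z : V, `|p - z| < d ->
    `|'D_a ('D_b g) p - 'D_a ('D_b g) z| < e / 2 /\
    `|'D_b ('D_a g) p - 'D_b ('D_a g) z| < e / 2.
  have /cvgrPdist_lt/(_ _ e2) n1 := cont a b.
  have /cvgrPdist_lt/(_ _ e2) n2 := cont b a.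
  have /nbhs_ballP[d /= d0 hd] : nbhs p [set z |
      `|'D_a ('D_b g) p - 'D_a ('D_b g) z| < e / 2 /\
      `|'D_b ('D_a g) p - 'D_b ('D_a g) z| < e / 2] by exact: filterI n1 n2.
  by exists d => // z pz; apply: hd; rewrite -ball_normE.
(* The summand 1 keeps [N] positive even when [a] and [b] vanish; with steps below [h = d / N], all
   intermediate points lie within [d] of [p]. *)
pose N := `|a| + `|b| + 1.
have N0 : 0 < N by rewrite ltr_wpDl// addr_ge0.
pose h := d / N.
have h0 : 0 < h by rewrite divr_gt0.
have close c c' s t : 0 < s < h -> 0 < t < h -> `|c| + `|c'| + 1 = N ->
    `|p - (s *: c + (t *: c' + p))| < d.
  move=> /andP[s0 sh] /andP[t0 th] cN.
  rewrite distrC addrA addrK; apply: le_lt_trans (ler_normD _ _) _.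
  rewrite !normrZ !gtr0_norm//.
  apply: (@le_lt_trans _ _ (h * (`|c| + `|c'|))).
    by rewrite mulrDr lerD// ler_wpM2r// ltW.
  by rewrite -[ltRHS](divfK (lt0r_neq0 N0)) -/h ltr_pM2l// -cN ltrDl.
have [s [t [hs ht E]]] := second_difference a b p Cg h0.
have [s' [t' [hs' ht' E']]] := second_difference b a p Cg h0.
have := E'; rewrite [h *: b + _]addrCA => E''.
have EE : 'D_b ('D_a g) (s *: a + (t *: b + p))
   = 'D_a ('D_b g) (s' *: b + (t' *: a + p)).
  apply: (mulfI (lt0r_neq0 (mulr_gt0 h0 h0))).
  refine (etrans (esym E) (etrans _ E'')).
  by rewrite !opprB -!addrA; congr (_ + _); rewrite addrC -addrA addrCA.
have [_ h1] := hd _ (close a b s t hs ht erefl).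
have cN : `|b| + `|a| + 1 = N by rewrite /N (addrC `|b|).
have [h2 _] := hd _ (close b a s' t' hs' ht' cN).
move: EE h1 h2; move: ('D_b _ (_ + _)) ('D_a _ (_ + _)) => X Y ->.
move: ('D_a _ p) ('D_b _ p) => X' Y' h1 h2.
rewrite -(subrKA Y) (le_trans (ler_normD _ _))// [e]splitr lerD// ltW//.
by rewrite distrC.
Qed.

End DirectionalDerivatives.

(** * Functions of class C^k *)

Section ClassC.
Context {R : realType}.
Implicit Types V W X : normedModType R.

(** Such a map is a finite sum of coordinates times fixed vectors. *)
Lemma linear_mx_continuous (a b : nat) W (A : {linear 'M[R]_(a, b) -> W}) :
  continuous A.
Proof.
have E : (A : _ -> _) = (fun M => \sum_i \sum_j M i j *: A (delta_mx i j)).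
  apply/funext => M; rewrite {1}[M]matrix_sum_delta linear_sum.
  by apply: eq_bigr => i _; rewrite linear_sum; apply: eq_bigr => j _; rewrite linearZ.
rewrite E; apply: continuous_big => [|i _]; first exact: add_continuous.
apply: continuous_big => [|j _]; first exact: add_continuous.
move=> M; have c := @coord_continuous R a b i j M; exact: cvgZr_tmp c.
Qed.

Lemma class_C_ext (k : nat) V W (U : set V) (g h : V -> W) :
  g =1 h -> class_C k U g -> class_C k U h.
Proof. by move=> /funext ->. Qed.

Lemma class_C_cst (k : nat) V W (c : W) : class_C k setT (fun _ : V => c).
Proof.
elim: k c => [|k IH] c /=; first by move=> p _; exact: cvg_cst.
split=> [p _|v]; first exact: differentiable_cst.
by apply: class_C_ext (IH 0) => p; rewrite derive_cst.
Qed.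

(** Differentiating along [v] gives ['D_(A v) g] composed with [A], so the induction meets only
    functions of the same shape. *)
Lemma class_C_comp_lin (k : nat) V W X (g : W -> X) (A : {linear V -> W}) :
  continuous A -> class_C k setT g -> class_C k setT (fun z => g (A z)).
Proof.
move=> cA; elim: k g => [|k IH] g /=.
  by move=> cg p _; apply: continuous_comp; [exact: cA|exact: cg].
move=> [dg Cg]; split=> [p _|v].
  apply: differentiable_comp; last exact: dg.
  exact: linear_differentiable.
by apply: class_C_ext (IH _ (Cg (A v))) => p; rewrite derive_comp_lin.
Qed.

Lemma class_C_id (k : nat) V : class_C k setT (@id V).
Proof.
case: k => [|k] /=; first by move=> p _; exact: cvg_id.
split=> [p _|v]; first by have [] := is_diff_id p.
by apply: class_C_ext (@class_C_cst k V V v) => p; rewrite derive_id.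
Qed.

Lemma class_C_lin (k : nat) V W (A : {linear V -> W}) :
  continuous A -> class_C k setT A.
Proof. by move=> cA; exact: (class_C_comp_lin cA (@class_C_id k W)). Qed.

Lemma class_CD (k : nat) V W (g h : V -> W) :
  class_C k setT g -> class_C k setT h -> class_C k setT (fun z => g z + h z).
Proof.
elim: k g h => [|k IH] g h /=.
  by move=> cg ch p _; apply: cvgD; [exact: cg|exact: ch].
move=> [dg Cg] [dh Ch]; split=> [p _|v].
  by apply: differentiableD; [exact: dg|exact: dh].
apply: class_C_ext (IH _ _ (Cg v) (Ch v)) => p.
by rewrite deriveD//; apply: diff_derivable; [exact: dg|exact: dh].
Qed.

Lemma class_CN (k : nat) V W (g : V -> W) :
  class_C k setT g -> class_C k setT (fun z => - g z).
Proof.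
elim: k g => [|k IH] g /=; first by move=> cg p _; apply: cvgN; exact: cg.
move=> [dg Cg]; split=> [p _|v]; first by apply: differentiableN; exact: dg.
apply: class_C_ext (IH _ (Cg v)) => p.
by rewrite deriveN//; apply: diff_derivable; exact: dg.
Qed.

Lemma class_CM (k : nat) V (g h : V -> R) :
  class_C k setT g -> class_C k setT h -> class_C k setT (fun z => g z * h z).
Proof.
elim: k g h => [|k IH] g h.
  by move=> cg ch p _; apply: cvgM; [exact: cg|exact: ch].
(* The product rule leaves one factor undifferentiated, so the induction hypothesis needs that
   factor at the lower order as well. *)
have lower (e : V -> R) : class_C k.+1 setT e -> class_C k setT e.
  elim: k e {IH} => [|k IH] e [de Ce] => [p _|].
    by apply: differentiable_continuous; exact: de.
  by split=> // v; apply: IH; exact: Ce.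
move=> /[dup] /lower Lg [dg Cg] /[dup] /lower Lh [dh Ch]; split=> [p _|v].
  by apply: differentiableM; [exact: dg|exact: dh].
apply: class_C_ext (class_CD (IH _ _ Lg (Ch v)) (IH _ _ Lh (Cg v))) => p.
by rewrite deriveM//; apply: diff_derivable; [exact: dg|exact: dh].
Qed.

Lemma class_C_sum (k : nat) V W (I : Type) (r : seq I) (g : I -> V -> W) :
  (forall i, class_C k setT (g i)) -> class_C k setT (fun z => \sum_(i <- r) g i z).
Proof.
move=> Cg; elim: r => [|i r IH].
  by apply: class_C_ext (@class_C_cst k V W 0) => z; rewrite big_nil.
by apply: class_C_ext (class_CD (Cg i) IH) => z; rewrite big_cons.
Qed.

Lemma dotpE (n : nat) (a b : 'cV[R]_n) : dotp a b = \sum_i a i 0 * b i 0.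
Proof. by rewrite /dotp mxE; apply: eq_bigr => i _; rewrite mxE. Qed.

Lemma class_C_coord (k n : nat) V (g : V -> 'cV[R]_n) i :
  class_C k setT g -> class_C k setT (fun z => g z i 0).
Proof.
elim: k g => [|k IH] g /=.
  move=> cg p _; apply: (@continuous_comp _ _ _ g (fun M : 'cV[R]_n => M i 0)).
    exact: cg.
  exact: coord_continuous.
move=> [dg Cg]; split=> [p _|v].
  apply: (@differentiable_comp _ _ _ _ g (fun M : 'cV[R]_n => M i 0)).
    exact: dg.
  exact: differentiable_coord.
apply: class_C_ext (IH _ (Cg v)) => p.
by rewrite derive_mx ?mxE//; apply: diff_derivable; exact: dg.
Qed.

Lemma class_C_dotp (k n : nat) V (g h : V -> 'cV[R]_n) :
  class_C k setT g -> class_C k setT h ->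
  class_C k setT (fun z => dotp (g z) (h z)).
Proof.
move=> Cg Ch; apply: (class_C_ext (fun z => esym (dotpE (g z) (h z)))).
by apply: class_C_sum => i; apply: class_CM; exact: class_C_coord.
Qed.

Lemma derive_lin V W (A : {linear V -> W}) v p : continuous A -> 'D_v A p = A v.
Proof.
by move=> cA; rewrite deriveE ?diff_lin//; exact: linear_differentiable.
Qed.

Lemma derive_dotp (n : nat) V (g h : V -> 'cV[R]_n) v p :
  differentiable g p -> differentiable h p ->
  'D_v (fun z => dotp (g z) (h z)) p =
  dotp ('D_v g p) (h p) + dotp (g p) ('D_v h p).
Proof.
move=> dg dh.
have D (k : V -> 'cV[R]_n) i : differentiable k p ->
    is_derive p v (fun z => k z i 0) ('D_v k p i 0).
  move=> dk; have der : derivable k p v by exact: diff_derivable.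
  by split; [exact: ((derivable_mxP _ _ _).1 der)|rewrite derive_mx ?mxE].
rewrite (_ : (fun z => _) = \sum_(i < n) (fun z => g z i 0 * h z i 0)); last first.
  by apply/funext => z; rewrite fct_sumE dotpE.
have [_ ->] := is_derive_sum (fun i => is_deriveM (D g i dg) (D h i dh)).
rewrite big_split addrC /= !dotpE; congr (_ + _).
by apply: eq_bigr => i _; rewrite [LHS]mulrC.
Qed.

Lemma derive_cV (n : nat) W (g : 'cV[R]_n -> W) u h : differentiable g u ->
  'D_h g u = \sum_i h i 0 *: 'D_(delta_mx i 0) g u.
Proof.
move=> dg; rewrite deriveE// {1}[h]matrix_sum_delta linear_sum.
by apply: eq_bigr => i _; rewrite big_ord1 linearZ deriveE.
Qed.

(** Expanding [z] in the standard basis in both slots turns the double sum of matrix entries into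
    one iterated directional derivative, on which definiteness can be read without matrices. *)
Lemma hess_form (n : nat) (g : 'cV[R]_n -> R) u z :
  (forall w, differentiable g w) ->
  (forall v w, differentiable ('D_v g) w) ->
  dotp z (hess g u *m z) = 'D_z ('D_z g) u.
Proof.
move=> d1 d2; rewrite (derive_cV _ (d2 z u)) dotpE.
have -> : 'D_z g = \sum_i (fun w => z i 0 *: 'D_(delta_mx i 0) g w).
  by apply/funext => w; rewrite derive_cV// fct_sumE.
under eq_bigr => i _ do rewrite mxE mulr_sumr.
rewrite exchange_big; apply: eq_bigr => j _ /=.
have DS i : is_derive u (delta_mx j 0) (fun w => z i 0 *: 'D_(delta_mx i 0) g w)
    (z i 0 *: 'D_(delta_mx j 0) ('D_(delta_mx i 0) g) u).
  by apply: is_deriveZ; apply: derivableP; exact: diff_derivable.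
have [_ ->] := is_derive_sum DS.
rewrite scaler_sumr; apply: eq_bigr => i _; rewrite !mxE.
have -> : (fun w => grad g w i 0) = 'D_(delta_mx i 0) g.
  by apply/funext => w; rewrite mxE.
by rewrite mulrA mulrC.
Qed.

End ClassC.

(** * Second derivatives of reduced functions *)

Section SecondDerivative.
Context {R : realType} {V : normedModType R}.
Variable g : V -> R.
Hypothesis Cg : class_C 2 setT g.

Definition second_derive (p u v : V) : R := 'D_v ('D_u g) p.

Lemma second_deriveC p u v : second_derive p u v = second_derive p v u.
Proof. exact: derive_symm. Qed.

Lemma second_deriveDr p u v w :
  second_derive p u (v + w) = second_derive p u v + second_derive p u w.
Proof. by apply: deriveDdir; exact: class_C2_diff2. Qed.

(** Symmetry moves the inner direction to the outer slot, where additivity is linearity of the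
    differential of ['D_w g]. *)
Lemma second_deriveDl p u v w :
  second_derive p (u + v) w = second_derive p u w + second_derive p v w.
Proof. by rewrite !(second_deriveC _ _ w) second_deriveDr. Qed.

Lemma second_derive0l p v : second_derive p 0 v = 0.
Proof. by rewrite second_deriveC /second_derive derive0. Qed.

End SecondDerivative.

Section Reduced.
Context {R : realType} {k p m : nat}.
Variable F : 'cV[R]_k -> 'cV[R]_p -> 'cV[R]_m -> R.
Local Notation E := ('cV[R]_k * 'cV[R]_p)%type.

Definition joint : E * 'cV[R]_m -> R := fun z => F z.1.1 z.1.2 z.2.

(** Difference quotients on a slice are those of the function on the product, so [G] may be
    arbitrary; this suits reduced functions, which are under control only on an open set. *)
Lemma hess_slice1 (G : 'cV[R]_k -> 'cV[R]_p -> R) a b i j :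
  hess (G ^~ b) a i j =
  second_derive (fun z : E => G z.1 z.2) (a, b) (delta_mx i 0, 0) (delta_mx j 0, 0).
Proof.
rewrite mxE.
rewrite (_ : (fun w => _) =
  fun w => 'D_(delta_mx i 0, 0) (fun z : E => G z.1 z.2) (w, b)).
  exact: (derive_slice1 ('D_(delta_mx i 0, 0) (fun z : E => G z.1 z.2))).
by apply/funext => w; rewrite mxE; exact: (derive_slice1 (fun z : E => G z.1 z.2)).
Qed.

Lemma hess_slice2 (G : 'cV[R]_k -> 'cV[R]_p -> R) a b i j :
  hess (G a) b i j =
  second_derive (fun z : E => G z.1 z.2) (a, b) (0, delta_mx i 0) (0, delta_mx j 0).
Proof.
rewrite mxE.
rewrite (_ : (fun w => _) =
  fun w => 'D_(0, delta_mx i 0) (fun z : E => G z.1 z.2) (a, w)).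
  exact: (derive_slice2 ('D_(0, delta_mx i 0) (fun z : E => G z.1 z.2))).
by apply/funext => w; rewrite mxE; exact: (derive_slice2 (fun z : E => G z.1 z.2)).
Qed.

Lemma mixed_hess_slice (G : 'cV[R]_k -> 'cV[R]_p -> R) a b i j :
  mixed_hess G a b i j =
  second_derive (fun z : E => G z.1 z.2) (a, b) (delta_mx i 0, 0) (0, delta_mx j 0).
Proof.
rewrite mxE.
rewrite (_ : (fun w => _) =
  fun w => 'D_(delta_mx i 0, 0) (fun z : E => G z.1 z.2) (a, w)).
  exact: (derive_slice2 ('D_(delta_mx i 0, 0) (fun z : E => G z.1 z.2))).
by apply/funext => w; rewrite mxE; exact: (derive_slice1 (fun z : E => G z.1 z.2)).
Qed.

Hypothesis CF : class_C 2 setT joint.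

Lemma differentiable_slice (W : normedModType R) (h : E * 'cV[R]_m -> W) a u :
  differentiable h (a, u) -> differentiable (fun w => h (a, w)) u.
Proof.
by move=> dh; apply: (@differentiable_comp _ _ _ _ (fun w => (a, w)) h).
Qed.

Lemma hess_control a b u z :
  dotp z (hess (F a b) u *m z) = second_derive joint ((a, b), u) (0, z) (0, z).
Proof.
have D v : 'D_v (F a b) = fun w => 'D_(0, v) joint ((a, b), w).
  by apply/funext => w; exact: (derive_slice2 joint (a, b) w v).
have d1 w : differentiable (F a b) w.
  exact: (differentiable_slice (class_C2_diff CF ((a, b), w))).
have d2 v w : differentiable ('D_v (F a b)) w.
  by rewrite D; exact: (differentiable_slice (class_C2_diff2 CF (0, v) ((a, b), w))).
rewrite (hess_form u z d1 d2) (D z); exact: (derive_slice2 ('D_(0, z) joint) (a, b) u z).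
Qed.

Variables (U : set E) (w : 'cV[R]_k -> 'cV[R]_p -> 'cV[R]_m).
Hypothesis Hw : critical_control F U w.

Definition law (z : E) := w z.1 z.2.

Lemma law_differentiable z : U z -> differentiable law z.
Proof. by case: Hw => _ [h _] _; exact: h. Qed.

(** The critical equation covers the basis directions of the control; differentiability extends it
    to every [h]. *)
Lemma derive_control0 h z : U z -> 'D_(0, h) joint (z, law z) = 0.
Proof.
case: z => a b Uz; rewrite -derive_slice2 derive_cV; last first.
  exact: (differentiable_slice (class_C2_diff CF ((a, b), law (a, b)))).
apply: big1 => i _; have [_ _ /(_ a b Uz)/matrixP/(_ i 0)] := Hw.
by rewrite !mxE => E; rewrite [X in _ *: X]E scaler0.
Qed.

Lemma derive_along_law (W : normedModType R) (g : E * 'cV[R]_m -> W) e z :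
  U z -> differentiable g (z, law z) ->
  'D_e (fun y => g (y, law y)) z = 'D_(e, 'D_e law z) g (z, law z).
Proof.
move=> Uz dg; have dl := law_differentiable Uz.
have di : differentiable (@id E) z by have [] := is_diff_id z.
have dp : differentiable (fun y => (y, law y)) z by exact: differentiable_pair.
refine (etrans (derive_comp e dp dg) _).
by rewrite (derive_pair e di dl) derive_id.
Qed.

(** Envelope theorem: the term carrying the derivative of the law is a control derivative at a
    critical control, hence zero. *)
Lemma derive_reduced e z : U z ->
  'D_e (fun y => reduced F w y.1 y.2) z = 'D_(e, 0) joint (z, law z).
Proof.
move=> Uz; have dJ := class_C2_diff CF (z, law z).
refine (etrans (derive_along_law e Uz dJ) _).
rewrite (_ : (e, 'D_e law z) = (e, 0) + (0, 'D_e law z)); last first.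
  by congr (_, _); rewrite /= ?addr0 ?add0r.
by rewrite (deriveDdir _ _ dJ) (derive_control0 _ Uz) addr0.
Qed.

Let nbhsU z : U z -> nbhs z U.
Proof. by case: Hw => oU _ _ Uz; exact: open_nbhs_nbhs. Qed.

(** The critical equation holds on a neighbourhood of [z], so it can be differentiated along the
    law; this is the implicit function equation for the sensitivity ['D_e law z]. *)
Lemma second_derive_control0 h e z : U z ->
  second_derive joint (z, law z) (0, h) (e, 'D_e law z) = 0.
Proof.
move=> Uz; have dJ := class_C2_diff2 CF (0, h) (z, law z).
refine (etrans (esym (derive_along_law e Uz dJ)) _).
refine (etrans _ (derive_cst (0 : R) z e)); apply: near_eq_derive.
by apply: filterS (nbhsU Uz) => y Uy; exact: derive_control0.
Qed.

(** The envelope formula holds near [z] and contains the law undifferentiated, so one more chain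
    rule suffices and a law of class C^1 is enough. *)
Lemma second_derive_reduced e e' z : U z ->
  second_derive (fun y => reduced F w y.1 y.2) z e e' =
  second_derive joint (z, law z) (e, 0) (e', 'D_e' law z).
Proof.
move=> Uz; have dJ := class_C2_diff2 CF (e, 0) (z, law z).
refine (etrans _ (derive_along_law e' Uz dJ)); apply: near_eq_derive.
by apply: filterS (nbhsU Uz) => y Uy; exact: derive_reduced.
Qed.

End Reduced.

(** * Bilinear terms plus a function read through a linear map *)

Section PairLinear.
Context {R : realType} {V W X : normedModType R}.
Variables (A : {linear V -> W}) (B : {linear V -> X}).

Definition pair_lin (z : V) : W * X := (A z, B z).

Fact pair_lin_is_linear : linear pair_lin.
Proof. by move=> c x y; rewrite /pair_lin !linearP. Qed.

HB.instance Definition _ :=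
  GRing.isLinear.Build R V (W * X)%type _ pair_lin pair_lin_is_linear.

Lemma pair_lin_continuous : continuous A -> continuous B -> continuous pair_lin.
Proof. by move=> cA cB x; apply: cvg_pair; [exact: cA|exact: cB]. Qed.

End PairLinear.

Section Pullback.
Context {R : realType} {n : nat} {V W : normedModType R}.
Variables (A B : {linear V -> 'cV[R]_n}) (D : {linear V -> W}) (g : W -> R).
Hypotheses (cA : continuous A) (cB : continuous B) (cD : continuous D).
Hypothesis Cg : class_C 2 setT g.

(** Common shape of the Hamiltonian and of the control Lagrangian, as functions of all their
    arguments including the control. *)
Definition pullback (z : V) : R := dotp (A z) (B z) + g (D z).

Lemma class_C_pullback : class_C 2 setT pullback.
Proof.
apply: class_CD; last exact: class_C_comp_lin.
by apply: class_C_dotp; exact: class_C_lin.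
Qed.

Lemma derive_pullback u p :
  'D_u pullback p = dotp (A u) (B p) + dotp (A p) (B u) + 'D_(D u) g (D p).
Proof.
have dA := linear_differentiable p cA; have dB := linear_differentiable p cB.
have dAB := class_C2_diff (class_C_dotp (class_C_lin 2 cA) (class_C_lin 2 cB)) p.
have dg := class_C2_diff (class_C_comp_lin cD Cg) p.
rewrite (deriveD (diff_derivable dAB) (diff_derivable dg)).
by rewrite (derive_dotp u dA dB) (derive_lin u p cA) (derive_lin u p cB) derive_comp_lin.
Qed.

Lemma second_derive_pullback p u v : second_derive pullback p u v =
  dotp (A u) (B v) + dotp (A v) (B u) + second_derive g (D p) (D u) (D v).
Proof.
have dA := linear_differentiable p cA; have dB := linear_differentiable p cB.
have dAc := differentiable_cst (A u) p; have dBc := differentiable_cst (B u) p.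
have d1 := class_C2_diff (class_C_dotp (@class_C_cst R 2 V _ (A u)) (class_C_lin 2 cB)) p.
have d2 := class_C2_diff (class_C_dotp (class_C_lin 2 cA) (@class_C_cst R 2 V _ (B u))) p.
have dg : differentiable (fun z => 'D_(D u) g (D z)) p.
  apply: (@differentiable_comp _ _ _ _ D ('D_(D u) g)).
    exact: linear_differentiable.
  exact: class_C2_diff2.
rewrite /second_derive (funext (derive_pullback u)).
rewrite (deriveD (diff_derivable (differentiableD d1 d2)) (diff_derivable dg)).
rewrite (deriveD (diff_derivable d1) (diff_derivable d2)).
rewrite (derive_dotp v dAc dB) (derive_dotp v dA dBc).
have -> : 'D_v (fun z => 'D_(D u) g (D z)) p = second_derive g (D p) (D u) (D v).
  exact: (derive_comp_lin ('D_(D u) g)).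
rewrite (derive_lin v p cA) (derive_lin v p cB) !derive_cst.
by rewrite /dotp trmx0 mul0mx mulmx0 mxE add0r addr0.
Qed.

End Pullback.

(** * Sensitivity of the control and the form left after its elimination *)

Section Sensitivity.
Context {R : realType} {Z W : normedModType R}.
Variables (g : Z * W -> R) (p : Z * W) (sens : Z -> W).
Hypothesis Cg : class_C 2 setT g.
Hypothesis nondeg : forall s, s != 0 -> second_derive g p (0, s) (0, s) < 0.
Hypothesis sensP : forall z h, second_derive g p (0, h) (z, sens z) = 0.

(** Two solutions differ by a pure control direction on which the quadratic form vanishes, and
    negative definiteness forces this direction to be zero. This is what identifies the
    sensitivities of the two control laws. *)
Lemma sens_unique z s :
  (forall h, second_derive g p (0, h) (z, s) = 0) -> s = sens z.
Proof.
move=> H; apply/eqP; rewrite -subr_eq0; apply/negPn/negP => /nondeg.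
have E : (z, s) = (z, sens z) + (0, s - sens z).
  by congr (_, _); rewrite /= ?addr0// addrC subrK.
by have := H (s - sens z); rewrite E second_deriveDr// sensP add0r => ->; rewrite ltxx.
Qed.

(* The Hessian of [g] with the control eliminated, i.e. a Schur complement. *)
Definition reduced_form (z z' : Z) : R := second_derive g p (z, 0) (z', sens z').

(** By [sensP], adding [(0, sens z)] to the first argument changes nothing, and the result is
    visibly symmetric. *)
Lemma reduced_formE z z' :
  reduced_form z z' = second_derive g p (z, sens z) (z', sens z').
Proof.
have -> : (z, sens z) = (z, 0) + (0, sens z).
  by congr (_, _); rewrite /= ?addr0 ?add0r.
by rewrite second_deriveDl// sensP addr0.
Qed.

Lemma reduced_formC z z' : reduced_form z z' = reduced_form z' z.
Proof. by rewrite !reduced_formE second_deriveC. Qed.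

Lemma reduced_form0l z : reduced_form 0 z = 0.
Proof. exact: second_derive0l. Qed.

End Sensitivity.

(** * Derivatives on [0, T] *)

Section DerivOn.
Context {R : realType}.
Variable T : R.
Implicit Types V W : normedModType R.

(** The relative derivative sees only [[0, T]], so identities known on that interval alone may be
    used to replace a curve. *)
Lemma deriv_on_ext V (g h : R -> V) t d : 0 <= t <= T ->
  (forall s, 0 <= s <= T -> g s = h s) -> deriv_on T g t d -> deriv_on T h t d.
Proof.
move=> tT gh; apply: cvg_trans; apply: near_eq_cvg.
have wT : within `[0, T] t^' `[0, T]%classic by exact: withinT.
apply: filterS wT => s /=; rewrite in_itv /= => sT.
by rewrite (gh _ tT) (gh _ sT).
Qed.

Lemma deriv_on_lin V W (A : {linear V -> W}) (g : R -> V) t d : continuous A ->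
  deriv_on T g t d -> deriv_on T (fun s => A (g s)) t (A d).
Proof.
move=> cA dg; rewrite /deriv_on.
rewrite (_ : (fun s => _) = (fun s => A ((s - t)^-1 *: (g s - g t)))); last first.
  by apply/funext => s; rewrite linearZ /= (raddfB A).
exact: (continuous_cvg _ (cA d) dg).
Qed.

Lemma deriv_onD V (g h : R -> V) t d d' :
  deriv_on T g t d -> deriv_on T h t d' ->
  deriv_on T (fun s => g s + h s) t (d + d').
Proof.
move=> dg dh; rewrite /deriv_on.
rewrite (_ : (fun s => _) =
  (fun s => (s - t)^-1 *: (g s - g t) + (s - t)^-1 *: (h s - h t))); last first.
  by apply/funext => s; rewrite -scalerDr opprD addrACA.
exact: cvgD dg dh.
Qed.

Lemma deriv_onN V (g : R -> V) t d :
  deriv_on T g t d -> deriv_on T (fun s => - g s) t (- d).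
Proof.
move=> dg; rewrite /deriv_on.
rewrite (_ : (fun s => _) = (fun s => - ((s - t)^-1 *: (g s - g t)))); last first.
  by apply/funext => s; rewrite -scalerN opprB opprK [- g s + _]addrC.
exact: cvgN dg.
Qed.

Lemma deriv_on_cst V (c : V) t : deriv_on T (fun _ => c) t 0.
Proof.
rewrite /deriv_on (_ : (fun s => _) = fun=> 0); first exact: cvg_cst.
by apply/funext => s; rewrite subrr scaler0.
Qed.

(** Every point of a nondegenerate interval is a limit of other points of it; uniqueness of the
    relative derivative rests on this. *)
Lemma within_itv_proper t : 0 < T -> 0 <= t <= T ->
  ProperFilter (within `[0, T] t^').
Proof.
move=> T0 /andP[t0 tT]; apply: Build_ProperFilter_ex => P.
move=> /nbhs_ballP[e /= e0 He].
have e2 : 0 < e / 2 by rewrite divr_gt0.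
have e2e : e / 2 < e by rewrite ltr_pdivrMr// ltr_pMr// ltr1n.
(* At [t = T] the nearby point is taken to the left, elsewhere to the right; the minimum keeps it
   both in the ball and in the interval. *)
move: tT; rewrite le_eqVlt => /orP[/eqP tT|tT].
  have m0 : 0 < Num.min (e / 2) t by rewrite lt_min e2 tT.
  exists (t - Num.min (e / 2) t); apply: He => /=.
  - by rewrite -ball_normE /= opprB addrC subrK gtr0_norm// gt_min e2e.
  - by rewrite -subr_eq0 addrAC subrr add0r oppr_eq0 lt0r_neq0.
  - by rewrite in_itv /= subr_ge0 ge_min lexx orbT -tT gerBl ltW.
have m0 : 0 < Num.min (e / 2) (T - t) by rewrite lt_min e2 subr_gt0.
exists (t + Num.min (e / 2) (T - t)); apply: He => /=.
- by rewrite -ball_normE /= opprD addrA subrr add0r normrN gtr0_norm// gt_min e2e.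
- by rewrite -subr_eq0 addrAC subrr add0r lt0r_neq0.
- rewrite in_itv /=; apply/andP; split; first by rewrite addr_ge0// ltW.
  by rewrite -lerBrDl ge_min lexx orbT.
Qed.

Lemma deriv_on_unique V (g : R -> V) t d d' : 0 < T -> 0 <= t <= T ->
  deriv_on T g t d -> deriv_on T g t d' -> d = d'.
Proof.
move=> T0 tT; have PF := within_itv_proper T0 tT.
exact: cvg_unique.
Qed.

End DerivOn.

Section DerivOnColumns.
Context {R : realType} {n : nat}.
Variable T : R.
Implicit Types (g h : R -> 'cV[R]_n) (v : R -> 'cV[R]_(n + n)).

Lemma deriv_on_usubmx v t d :
  deriv_on T v t d -> deriv_on T (fun s => usubmx (v s)) t (usubmx d).
Proof. by apply: deriv_on_lin; exact: linear_mx_continuous. Qed.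

Lemma deriv_on_dsubmx v t d :
  deriv_on T v t d -> deriv_on T (fun s => dsubmx (v s)) t (dsubmx d).
Proof. by apply: deriv_on_lin; exact: linear_mx_continuous. Qed.

Lemma deriv_on_col_mx g h t d d' : deriv_on T g t d -> deriv_on T h t d' ->
  deriv_on T (fun s => col_mx (g s) (h s)) t (col_mx d d').
Proof.
move=> dg dh.
(* Stacking is written as a sum of two linear maps, so that the rules for sums and linear images
   apply. *)
have E a b : col_mx a b =
    col_mx 1%:M 0 *m a + col_mx 0 1%:M *m b :> 'cV[R]_(n + n).
  by rewrite !mul_col_mx !mul1mx !mul0mx add_col_mx addr0 add0r.
rewrite E (_ : (fun s => _) = fun s => col_mx 1%:M 0 *m g s + col_mx 0 1%:M *m h s).
  by apply: deriv_onD; apply: deriv_on_lin => //; exact: linear_mx_continuous.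
by apply/funext => s; exact: E.
Qed.

End DerivOnColumns.

(** * Block form of the linearised systems *)

Section Blocks.
Context {R : realType} {n : nat}.
Local Notation V := 'cV[R]_(n + n).
Local Notation Z := ('cV[R]_n * 'cV[R]_n * 'cV[R]_n)%type.

Lemma delta_lshift (i : 'I_n) : delta_mx (lshift n i) 0 = col_mx (delta_mx i 0) 0 :> V.
Proof.
apply/colP => j; case: (split_ordP j) => k ->.
  by rewrite col_mxEu !mxE (inj_eq (@lshift_inj _ _)).
by rewrite col_mxEd !mxE eq_rlshift.
Qed.

Lemma delta_rshift (i : 'I_n) : delta_mx (rshift n i) 0 = col_mx 0 (delta_mx i 0) :> V.
Proof.
apply/colP => j; case: (split_ordP j) => k ->.
  by rewrite col_mxEu !mxE eq_lrshift.
by rewrite col_mxEd !mxE (inj_eq (@rshift_inj _ _)).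
Qed.

Lemma dotp0l (a : 'cV[R]_n) : dotp 0 a = 0.
Proof. by rewrite /dotp trmx0 mul0mx mxE. Qed.

Lemma dotp0r (a : 'cV[R]_n) : dotp a 0 = 0.
Proof. by rewrite /dotp mulmx0 mxE. Qed.

Lemma dotp_delta (i j : 'I_n) :
  dotp (delta_mx i 0) (delta_mx j 0) = (i == j)%:R :> R.
Proof. by rewrite /dotp trmx_delta mul_delta_mx_cond mulmxnE mxE. Qed.

(* The arguments (q, v, kappa) of the common part kappa^T f - C, read off (x, l)
   and (y, yd) respectively. *)
Definition ham_state (z : V * V) : Z := (usubmx z.1, dsubmx z.1, dsubmx z.2).
Definition lag_state (z : V * V) : Z := (usubmx z.1, usubmx z.2, dsubmx z.1).

Fact ham_state_is_linear : linear ham_state.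
Proof. by move=> c a b; rewrite /ham_state !linearP. Qed.

Fact lag_state_is_linear : linear lag_state.
Proof. by move=> c a b; rewrite /lag_state !linearP. Qed.

HB.instance Definition _ :=
  GRing.isLinear.Build R (V * V)%type Z _ ham_state ham_state_is_linear.
HB.instance Definition _ :=
  GRing.isLinear.Build R (V * V)%type Z _ lag_state lag_state_is_linear.

Lemma continuous_usubmx_comp (W : normedModType R) (h : W -> V) :
  continuous h -> continuous (fun z => usubmx (h z)).
Proof.
move=> ch z; apply: (@continuous_comp _ _ _ h usubmx); first exact: ch.
exact: linear_mx_continuous.
Qed.

Lemma continuous_dsubmx_comp (W : normedModType R) (h : W -> V) :
  continuous h -> continuous (fun z => dsubmx (h z)).
Proof.
move=> ch z; apply: (@continuous_comp _ _ _ h dsubmx); first exact: ch.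
exact: linear_mx_continuous.
Qed.

Let continuous_pair (W X Y : normedModType R) (g : W -> X) (h : W -> Y) :
  continuous g -> continuous h -> continuous (fun z => (g z, h z)).
Proof. by move=> cg ch z; apply: cvg_pair; [exact: cg|exact: ch]. Qed.

Lemma ham_state_continuous : continuous ham_state.
Proof.
apply: continuous_pair; last first.
  by apply: continuous_dsubmx_comp => z; exact: cvg_snd.
apply: continuous_pair.
  by apply: continuous_usubmx_comp => z; exact: cvg_fst.
by apply: continuous_dsubmx_comp => z; exact: cvg_fst.
Qed.

Lemma lag_state_continuous : continuous lag_state.
Proof.
apply: continuous_pair; last first.
  by apply: continuous_dsubmx_comp => z; exact: cvg_fst.
apply: continuous_pair.
  by apply: continuous_usubmx_comp => z; exact: cvg_fst.
by apply: continuous_usubmx_comp => z; exact: cvg_snd.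
Qed.

Lemma ham_stateE a b : ham_state (a, b) = (usubmx a, dsubmx a, dsubmx b).
Proof. by []. Qed.

Lemma lag_stateE a b : lag_state (a, b) = (usubmx a, usubmx b, dsubmx a).
Proof. by []. Qed.

Variable G : Z -> Z -> R.
Hypothesis GC : forall z z', G z z' = G z' z.
Hypothesis G0l : forall z, G 0 z = 0.

Let G0r z : G z 0 = 0. Proof. by rewrite GC G0l. Qed.

Definition in_q (e : 'cV[R]_n) : Z := (e, 0, 0).
Definition in_v (e : 'cV[R]_n) : Z := (0, e, 0).
Definition in_k (e : 'cV[R]_n) : Z := (0, 0, e).

(** With [a] and [b] among [in_q], [in_v], [in_k], these are the blocks A_qq, A_qv, ... of the
    symmetric form. *)
Definition form_block (a b : 'cV[R]_n -> Z) : 'M[R]_n :=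
  \matrix_(i, j) G (a (delta_mx i 0)) (b (delta_mx j 0)).

Lemma form_blockT a b : (form_block a b)^T = form_block b a.
Proof. by apply/matrixP => i j; rewrite !mxE GC. Qed.

Let blockE := (@block_mxEul R, @block_mxEur R, @block_mxEdl R, @block_mxEdr R).
Let subE := (@col_mxKu R, @col_mxKd R, dotp0l, dotp0r, dotp_delta).

Section Ham.
Variables (H : V -> V -> R) (a b : V).
Hypothesis HE : forall e e',
  second_derive (fun z : V * V => H z.1 z.2) (a, b) e e' =
  dotp (usubmx e.2) (dsubmx e'.1) + dotp (usubmx e'.2) (dsubmx e.1)
  + G (ham_state e) (ham_state e').

(** As [ham_state] drops l_q, the l_q column receives only the bilinear term l_q^T v, whence the
    blocks [0] and [1%:M]. *)
Lemma ham_mixed : mixed_hess H a b =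
  block_mx 0 (form_block in_q in_k) 1%:M (form_block in_v in_k).
Proof.
apply/matrixP => i j; rewrite mixed_hess_slice HE !ham_stateE /=.
case: (split_ordP i) => i' ->; case: (split_ordP j) => j' ->;
rewrite blockE ?delta_lshift ?delta_rshift !linear0 !subE !mxE;
by rewrite ?G0l ?G0r ?add0r ?addr0 // eq_sym.
Qed.

Lemma ham_hess_l : hess (H a) b = block_mx 0 0 0 (form_block in_k in_k).
Proof.
apply/matrixP => i j; rewrite hess_slice2 HE !ham_stateE /=.
case: (split_ordP i) => i' ->; case: (split_ordP j) => j' ->;
rewrite blockE ?delta_lshift ?delta_rshift !linear0 !subE !mxE;
by rewrite ?G0l ?G0r ?add0r ?addr0.
Qed.

Lemma ham_hess_x : hess (H ^~ b) a =
  block_mx (form_block in_q in_q) (form_block in_q in_v)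
           (form_block in_q in_v)^T (form_block in_v in_v).
Proof.
apply/matrixP => i j; rewrite hess_slice1 HE !ham_stateE /= form_blockT.
case: (split_ordP i) => i' ->; case: (split_ordP j) => j' ->;
rewrite blockE ?delta_lshift ?delta_rshift !linear0 !subE !mxE;
by rewrite ?add0r.
Qed.

End Ham.

Section Lag.
Variables (L : V -> V -> R) (a b : V).
Hypothesis LE : forall e e',
  second_derive (fun z : V * V => L z.1 z.2) (a, b) e e' =
  dotp (dsubmx e.2) (usubmx e'.2) + dotp (dsubmx e'.2) (usubmx e.2)
  + G (lag_state e) (lag_state e').

(** The v_kappa column vanishes: [lag_state] drops v_kappa, and the term v_kappa^T v_q involves no
    component of y. *)
Lemma lag_mixed : mixed_hess L a b =
  block_mx (form_block in_q in_v) 0 (form_block in_v in_k)^T 0.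
Proof.
apply/matrixP => i j; rewrite mixed_hess_slice LE !lag_stateE /= form_blockT.
case: (split_ordP i) => i' ->; case: (split_ordP j) => j' ->;
rewrite blockE ?delta_lshift ?delta_rshift !linear0 !subE !mxE;
by rewrite ?G0l ?G0r ?add0r ?addr0.
Qed.

Lemma lag_hess_yd : hess (L a) b = block_mx (form_block in_v in_v) 1%:M 1%:M 0.
Proof.
apply/matrixP => i j; rewrite hess_slice2 LE !lag_stateE /=.
case: (split_ordP i) => i' ->; case: (split_ordP j) => j' ->;
rewrite blockE ?delta_lshift ?delta_rshift !linear0 !subE !mxE;
by rewrite ?G0l ?G0r ?add0r ?addr0 // eq_sym.
Qed.

Lemma lag_hess_y : hess (L ^~ b) a =
  block_mx (form_block in_q in_q) (form_block in_q in_k)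
           (form_block in_q in_k)^T (form_block in_k in_k).
Proof.
apply/matrixP => i j; rewrite hess_slice1 LE !lag_stateE /= form_blockT.
case: (split_ordP i) => i' ->; case: (split_ordP j) => j' ->;
rewrite blockE ?delta_lshift ?delta_rshift !linear0 !subE !mxE;
by rewrite ?add0r.
Qed.

End Lag.
End Blocks.

(** * Equivalence of the two linear systems in block form *)

Section ConjugateTimes.
Context {R : realType} {n : nat}.
Local Notation V := 'cV[R]_(n + n).
Variables (H L : V -> V -> R) (T : R) (x l y yd : R -> V).
Variables Aqq Aqv Aqk Avv Avk Akk : R -> 'M[R]_n.
Hypothesis T0 : 0 < T.
Hypothesis Hxl : forall t, 0 <= t <= T ->
  mixed_hess H (x t) (l t) = block_mx 0 (Aqk t) 1%:M (Avk t).
Hypothesis Hll : forall t, 0 <= t <= T ->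
  hess (H (x t)) (l t) = block_mx 0 0 0 (Akk t).
Hypothesis Hxx : forall t, 0 <= t <= T ->
  hess (H ^~ (l t)) (x t) = block_mx (Aqq t) (Aqv t) (Aqv t)^T (Avv t).
Hypothesis Lyd : forall t, 0 <= t <= T ->
  mixed_hess L (y t) (yd t) = block_mx (Aqv t) 0 (Avk t)^T 0.
Hypothesis Ldd : forall t, 0 <= t <= T ->
  hess (L (y t)) (yd t) = block_mx (Avv t) 1%:M 1%:M 0.
Hypothesis Lyy : forall t, 0 <= t <= T ->
  hess (L ^~ (yd t)) (y t) = block_mx (Aqq t) (Aqk t) (Aqk t)^T (Akk t).

Let split_mul (A B C D : 'M[R]_n) (u : V) :
  block_mx A B C D *m u =
  col_mx (A *m usubmx u + B *m dsubmx u) (C *m usubmx u + D *m dsubmx u).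
Proof. by rewrite -{1}[u]vsubmxK mul_block_col. Qed.

Lemma ham_dx t (dx dl : V) : 0 <= t <= T ->
  (mixed_hess H (x t) (l t))^T *m dx + hess (H (x t)) (l t) *m dl =
  col_mx (dsubmx dx) ((Aqk t)^T *m usubmx dx + (Avk t)^T *m dsubmx dx
                      + Akk t *m dsubmx dl).
Proof.
move=> tT; rewrite Hxl// Hll// tr_block_mx !split_mul add_col_mx.
by rewrite trmx0 trmx1 mul1mx !mul0mx !add0r !addr0.
Qed.

Lemma ham_dl t (dx dl : V) : 0 <= t <= T ->
  - (hess (H ^~ (l t)) (x t) *m dx) - mixed_hess H (x t) (l t) *m dl =
  col_mx (- (Aqq t *m usubmx dx + Aqv t *m dsubmx dx + Aqk t *m dsubmx dl))
         (- ((Aqv t)^T *m usubmx dx + Avv t *m dsubmx dx + usubmx dl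
             + Avk t *m dsubmx dl)).
Proof.
move=> tT; rewrite Hxl// Hxx// !split_mul !opp_col_mx add_col_mx.
by rewrite mul1mx !mul0mx !add0r !opprD !addrA.
Qed.

(** The momentum conjugate to kappa is simply the velocity of dq, so the second block of the Jacobi
    equation is the linearised dynamics of v. *)
Lemma lag_momentum t (dy dyd : V) : 0 <= t <= T ->
  (mixed_hess L (y t) (yd t))^T *m dy + hess (L (y t)) (yd t) *m dyd =
  col_mx ((Aqv t)^T *m usubmx dy + Avk t *m dsubmx dy + Avv t *m usubmx dyd
          + dsubmx dyd)
         (usubmx dyd).
Proof.
move=> tT; rewrite Lyd// Ldd// tr_block_mx !split_mul add_col_mx.
by rewrite !trmx0 trmxK !mul1mx !mul0mx !add0r !addr0 !addrA.
Qed.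

Lemma lag_force t (dy dyd : V) : 0 <= t <= T ->
  hess (L ^~ (yd t)) (y t) *m dy + mixed_hess L (y t) (yd t) *m dyd =
  col_mx (Aqq t *m usubmx dy + Aqk t *m dsubmx dy + Aqv t *m usubmx dyd)
         ((Aqk t)^T *m usubmx dy + Akk t *m dsubmx dy + (Avk t)^T *m usubmx dyd).
Proof.
move=> tT; rewrite Lyd// Lyy// !split_mul add_col_mx.
by rewrite !mul0mx !addr0.
Qed.

(** The pair (dq, dl_v), with its velocity read off the Hamiltonian system, has Jacobi momentum (-
    dl_q, dv). The coefficients need not be differentiable in time, since this momentum is
    differentiated as a whole. *)
Lemma conjugate_time_ham_lag tc :
  hamiltonian_conjugate_time H T x l tc -> lagrangian_conjugate_time L T y yd tc.
Proof.
move=> [tcT [dx [dl [sol nz dx0 dxtc]]]]; split=> //.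
pose dyd s := col_mx (dsubmx (dx s))
  (- ((Aqv s)^T *m usubmx (dx s) + Avv s *m dsubmx (dx s) + usubmx (dl s)
      + Avk s *m dsubmx (dl s))).
pose dy s := col_mx (usubmx (dx s)) (dsubmx (dl s)).
have dq t : 0 <= t <= T ->
    deriv_on T (fun s => usubmx (dx s)) t (dsubmx (dx t)).
  move=> tT; have [/deriv_on_usubmx] := sol t tT.
  by rewrite (ham_dx (dx t) (dl t) tT) col_mxKu.
have dv t : 0 <= t <= T -> deriv_on T (fun s => dsubmx (dx s)) t
   ((Aqk t)^T *m usubmx (dx t) + (Avk t)^T *m dsubmx (dx t) + Akk t *m dsubmx (dl t)).
  move=> tT; have [/deriv_on_dsubmx] := sol t tT.
  by rewrite (ham_dx (dx t) (dl t) tT) col_mxKd.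
have dlq t : 0 <= t <= T -> deriv_on T (fun s => usubmx (dl s)) t
   (- (Aqq t *m usubmx (dx t) + Aqv t *m dsubmx (dx t) + Aqk t *m dsubmx (dl t))).
  move=> tT; have [_ /deriv_on_usubmx] := sol t tT.
  by rewrite (ham_dl (dx t) (dl t) tT) col_mxKu.
have dlv t : 0 <= t <= T -> deriv_on T (fun s => dsubmx (dl s)) t (dsubmx (dyd t)).
  move=> tT; have [_ /deriv_on_dsubmx] := sol t tT.
  by rewrite (ham_dl (dx t) (dl t) tT) /dyd !col_mxKd.
exists dy, dyd; split.
- move=> t tT; split.
    rewrite -[dyd t]vsubmxK {1}/dyd col_mxKu.
    by apply: deriv_on_col_mx; [exact: dq|exact: dlv].
  (* The derivative of (- dl_q, dv) comes from the Hamiltonian equations and is then transferred to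
     the momentum, which equals it on [[0, T]]. *)
  have dmom := deriv_on_col_mx (deriv_onN (dlq t tT)) (dv t tT).
  rewrite opprK (addrAC (Aqq t *m _)) (addrAC ((Aqk t)^T *m _)) in dmom.
  rewrite (lag_force (dy t) (dyd t) tT) /dy /dyd !col_mxKu !col_mxKd.
  apply: deriv_on_ext tT _ dmom => s sT.
  rewrite (lag_momentum (dy s) (dyd s) sT) /dy /dyd !col_mxKu !col_mxKd.
  by congr col_mx; apply/colP => i; rewrite !mxE; ring.
(* If [dy] vanished on all of [[0, T]], so would dq and dl_v, hence also their derivatives; the
   equation for dl_v then leaves dl_q = 0, and [(dx, dl)] would vanish at [t0]. *)
- case: nz => t0 t0T; apply: contraNP => /forall2NP dy0.
  have {}dy0 t : 0 <= t <= T -> dy t = 0.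
    by move=> tT; case: (dy0 t) => // /negP/negPn/eqP.
  have q0 t : 0 <= t <= T -> usubmx (dx t) = 0.
    by move=> /dy0 /(congr1 usubmx); rewrite col_mxKu linear0.
  have k0 t : 0 <= t <= T -> dsubmx (dl t) = 0.
    by move=> /dy0 /(congr1 dsubmx); rewrite col_mxKd linear0.
  have v0 t : 0 <= t <= T -> dsubmx (dx t) = 0.
    move=> tT; apply: (deriv_on_unique T0 tT (dq t tT)).
    by apply: (deriv_on_ext tT _ (deriv_on_cst T 0 t)) => s sT; rewrite q0.
  have kd0 : dsubmx (dyd t0) = 0.
    apply: (deriv_on_unique T0 t0T (dlv t0 t0T)).
    by apply: (deriv_on_ext t0T _ (deriv_on_cst T 0 t0)) => s sT; rewrite k0.
  have p0 : usubmx (dl t0) = 0.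
    move: kd0; rewrite /dyd col_mxKd q0// v0// k0// !mulmx0 !add0r addr0.
    by move/eqP; rewrite oppr_eq0 => /eqP.
  by rewrite -[dx t0]vsubmxK -[dl t0]vsubmxK q0// v0// k0// p0 col_mx0.
- by rewrite /dy /dyd !col_mxKu dx0 !linear0.
- by rewrite /dy /dyd !col_mxKu dxtc !linear0.
Qed.

(** Inverse substitution: dl_q is minus the momentum conjugate to q, which is differentiable by the
    Jacobi equation, and dl_v is dkappa. *)
Lemma conjugate_time_lag_ham tc :
  lagrangian_conjugate_time L T y yd tc -> hamiltonian_conjugate_time H T x l tc.
Proof.
move=> [tcT [dy [dyd [sol nz dy0 dytc]]]]; split=> //.
pose mom s := (Aqv s)^T *m usubmx (dy s) + Avk s *m dsubmx (dy s)
  + Avv s *m usubmx (dyd s) + dsubmx (dyd s).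
have dmom t : 0 <= t <= T ->
    deriv_on T (fun s => col_mx (mom s) (usubmx (dyd s))) t
    (col_mx (Aqq t *m usubmx (dy t) + Aqk t *m dsubmx (dy t) + Aqv t *m usubmx (dyd t))
       ((Aqk t)^T *m usubmx (dy t) + Akk t *m dsubmx (dy t)
        + (Avk t)^T *m usubmx (dyd t))).
  move=> tT; have [_] := sol t tT; rewrite (lag_force (dy t) (dyd t) tT).
  by apply: deriv_on_ext => // s sT; rewrite lag_momentum.
exists (fun s => col_mx (usubmx (dy s)) (usubmx (dyd s))).
exists (fun s => col_mx (- mom s) (dsubmx (dy s))); split.
- move=> t tT; have [ddy _] := sol t tT.
  rewrite (ham_dx _ _ tT) (ham_dl _ _ tT) !col_mxKu !col_mxKd.
  split; apply: deriv_on_col_mx.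
  + exact: deriv_on_usubmx ddy.
  + have := deriv_on_dsubmx (dmom t tT); rewrite col_mxKd addrAC.
    by under eq_fun do rewrite col_mxKd.
  + have := deriv_onN (deriv_on_usubmx (dmom t tT)); rewrite col_mxKu addrAC.
    by under eq_fun do rewrite col_mxKu.
  (* The definition of [mom] is solved for the velocity of dkappa. *)
  + rewrite (_ : - _ = dsubmx (dyd t)); first exact: deriv_on_dsubmx ddy.
    by rewrite /mom; apply/colP => i; rewrite !mxE; ring.
- case: nz => t tT nz; exists t => //; apply: contraNN nz => /eqP[].
  move=> /(congr1 usubmx); rewrite col_mxKu linear0 => q0.
  move=> /(congr1 dsubmx); rewrite col_mxKd linear0 => k0.
  by rewrite -[dy t]vsubmxK q0 k0 col_mx0.
- by case: dy0 => -> ->; rewrite col_mx0.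
- by case: dytc => -> ->; rewrite col_mx0.
Qed.

End ConjugateTimes.

(** * The Hamiltonian and the Lagrangian of the problem *)

Section PulledBackLaw.
Context {R : realType} {k p m n : nat} {Z : normedModType R}.
Local Notation E := ('cV[R]_k * 'cV[R]_p)%type.
Local Notation W := 'cV[R]_m.
Variables (A B : {linear E -> 'cV[R]_n}) (S : {linear E -> Z}) (g : Z * W -> R).
Hypotheses (cA : continuous A) (cB : continuous B) (cS : continuous S).
Hypothesis Cg : class_C 2 setT g.
Variable F : 'cV[R]_k -> 'cV[R]_p -> W -> R.
Hypothesis FE : forall a b u, F a b u = dotp (A (a, b)) (B (a, b)) + g (S (a, b), u).

Let fst_comp_continuous (X : normedModType R) (h : E -> X) :
  continuous h -> continuous (fun z : E * W => h z.1).
Proof.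
move=> ch z; apply: (@continuous_comp _ _ _ fst h); [exact: cvg_fst|exact: ch].
Qed.

Let A' : {linear (E * W)%type -> 'cV[R]_n} := A \o fst.
Let B' : {linear (E * W)%type -> 'cV[R]_n} := B \o fst.
Let S' : {linear (E * W)%type -> (Z * W)%type} := pair_lin (S \o fst) snd.

Let cA' : continuous A'. Proof. exact: fst_comp_continuous. Qed.
Let cB' : continuous B'. Proof. exact: fst_comp_continuous. Qed.
Let cS' : continuous S'.
Proof.
by apply: pair_lin_continuous; [exact: fst_comp_continuous|move=> z; exact: cvg_snd].
Qed.

Let jointE : joint F = pullback A' B' S' g.
Proof. by apply/funext => -[[a b] u]; exact: FE. Qed.

Lemma class_C_joint : class_C 2 setT (joint F).
Proof. by rewrite jointE; exact: class_C_pullback. Qed.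

Lemma second_derive_joint z u e s e' s' :
  second_derive (joint F) (z, u) (e, s) (e', s') =
  dotp (A e) (B e') + dotp (A e') (B e)
  + second_derive g (S z, u) (S e, s) (S e', s').
Proof. by rewrite jointE (second_derive_pullback cA' cB' cS' Cg). Qed.

(** The bilinear term does not involve the control, so the strong Legendre condition becomes a
    property of [g] alone. *)
Lemma hess_control_pulled a b u z :
  dotp z (hess (F a b) u *m z) = second_derive g (S (a, b), u) (0, z) (0, z).
Proof.
rewrite (hess_control class_C_joint) second_derive_joint !linear0.
by rewrite dotp0l addr0 add0r.
Qed.

Variables (U : set E) (w : 'cV[R]_k -> 'cV[R]_p -> W).
Hypothesis Hw : critical_control F U w.

Lemma derive_reduced_pulled z e : U z ->
  'D_e (fun y => reduced F w y.1 y.2) z =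
  dotp (A e) (B z) + dotp (A z) (B e) + 'D_(S e, 0) g (S z, law w z).
Proof.
move=> Uz; rewrite (derive_reduced class_C_joint Hw _ Uz) jointE.
by rewrite (derive_pullback cA' cB' cS' Cg).
Qed.

Lemma second_derive_reduced_pulled z e e' : U z ->
  second_derive (fun y => reduced F w y.1 y.2) z e e' =
  dotp (A e) (B e') + dotp (A e') (B e)
  + second_derive g (S z, law w z) (S e, 0) (S e', 'D_e' (law w) z).
Proof.
move=> Uz; rewrite (second_derive_reduced class_C_joint Hw _ _ Uz).
exact: second_derive_joint.
Qed.

(** The bilinear term vanishes against a pure control direction; what remains involves only [g] and
    [S e], and so has the same form for both control laws. *)
Lemma law_sens z e h : U z ->
  second_derive g (S z, law w z) (0, h) (S e, 'D_e (law w) z) = 0.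
Proof.
move=> Uz; have := second_derive_control0 class_C_joint Hw h e Uz.
by rewrite second_derive_joint !linear0 dotp0l dotp0r !add0r.
Qed.

End PulledBackLaw.

Section CommonPart.
Context {R : realType} {n m : nat}.
Variable f : 'cV[R]_n -> 'cV[R]_n -> 'cV[R]_m -> 'cV[R]_n.
Variable C : 'cV[R]_n -> 'cV[R]_n -> 'cV[R]_m -> R.
Local Notation V := 'cV[R]_(n + n).
Local Notation Z := ('cV[R]_n * 'cV[R]_n * 'cV[R]_n)%type.

(* Both the Hamiltonian and the control Lagrangian are a bilinear form plus this
   function of (q, v, kappa, u). *)
Definition common_part (z : Z * 'cV[R]_m) : R :=
  dotp z.1.2 (f z.1.1.1 z.1.1.2 z.2) - C z.1.1.1 z.1.1.2 z.2.

Hypothesis hf : class_C 2 setT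
  (fun p : ('cV[R]_n * 'cV[R]_n * 'cV[R]_m)%type => f p.1.1 p.1.2 p.2).
Hypothesis hC : class_C 2 setT
  (fun p : ('cV[R]_n * 'cV[R]_n * 'cV[R]_m)%type => C p.1.1 p.1.2 p.2).

Lemma class_C_common_part : class_C 2 setT common_part.
Proof.
pose D : {linear (Z * 'cV[R]_m)%type -> _} := pair_lin (fst \o fst) snd.
have c1 : continuous (fun z : Z * 'cV[R]_m => z.1.1).
  by move=> z; apply: (@continuous_comp _ _ _ fst fst); exact: cvg_fst.
have c2 : continuous (fun z : Z * 'cV[R]_m => z.1.2).
  by move=> z; apply: (@continuous_comp _ _ _ fst snd); [exact: cvg_fst|exact: cvg_snd].
have cD : continuous D.
  by apply: pair_lin_continuous => // z; exact: cvg_snd.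
pose K : {linear (Z * 'cV[R]_m)%type -> 'cV[R]_n} := snd \o fst.
apply: class_CD; last by apply: class_CN; exact: (class_C_comp_lin cD hC).
apply: class_C_dotp; last exact: (class_C_comp_lin cD hf).
exact: (@class_C_lin _ 2 _ _ K).
Qed.

(** The factors of l_q^T v and of v_kappa^T v_q, packaged as linear maps on the product. *)
Definition ham_p : {linear (V * V)%type -> 'cV[R]_n} := usubmx \o snd.
Definition ham_v : {linear (V * V)%type -> 'cV[R]_n} := dsubmx \o fst.
Definition lag_vk : {linear (V * V)%type -> 'cV[R]_n} := dsubmx \o snd.
Definition lag_vq : {linear (V * V)%type -> 'cV[R]_n} := usubmx \o snd.

Lemma normal_hamE a b u : normal_ham f C a b u =
  dotp (ham_p (a, b)) (ham_v (a, b)) + common_part (ham_state (a, b), u).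
Proof. by rewrite /normal_ham /pontryagin_ham mulN1r -addrA. Qed.

Lemma control_lagrangianE a b u : control_lagrangian f C a b u =
  dotp (lag_vk (a, b)) (lag_vq (a, b)) + common_part (lag_state (a, b), u).
Proof. by rewrite /control_lagrangian -addrA. Qed.

End CommonPart.

Theorem theorem4p3 (R : realType) (n m : nat)
  (f : 'cV[R]_n -> 'cV[R]_n -> 'cV[R]_m -> 'cV[R]_n)
  (C : 'cV[R]_n -> 'cV[R]_n -> 'cV[R]_m -> R)
  (T : R) (q0 v0 qT vT : 'cV[R]_n)
  (hT : 0 < T)
  (hf : class_C 2 setT
     (fun p : ('cV[R]_n * 'cV[R]_n * 'cV[R]_m)%type => f p.1.1 p.1.2 p.2))
  (hC : class_C 2 setT
     (fun p : ('cV[R]_n * 'cV[R]_n * 'cV[R]_m)%type => C p.1.1 p.1.2 p.2))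
  (* Hamiltonian side: control law u^*(x, l) on U, extremal (x, l) *)
  (U : set ('cV[R]_(n + n) * 'cV[R]_(n + n))%type)
  (ustar : 'cV[R]_(n + n) -> 'cV[R]_(n + n) -> 'cV[R]_m)
  (hustar : critical_control (normal_ham f C) U ustar)
  (x l : R -> 'cV[R]_(n + n))
  (hU : forall t, 0 <= t <= T -> U (x t, l t))
  (hext : hamiltonian_solution (reduced (normal_ham f C) ustar) T x l)
  (hx0 : x 0 = col_mx q0 v0) (hxT : x T = col_mx qT vT)
  (hlegendre : strong_legendre f C T x l (fun t => ustar (x t) (l t)))
  (hcorank : corank1 f C T x (fun t => ustar (x t) (l t)))
  (* Lagrangian side: control law u(y, yd) on V, with the same control along
     the corresponding curve y = (q, l_v) *)
  (V : set ('cV[R]_(n + n) * 'cV[R]_(n + n))%type)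
  (uy : 'cV[R]_(n + n) -> 'cV[R]_(n + n) -> 'cV[R]_m)
  (huy : critical_control (control_lagrangian f C) V uy)
  (y yd : R -> 'cV[R]_(n + n))
  (hy : forall t, 0 <= t <= T -> y t = col_mx (usubmx (x t)) (dsubmx (l t)))
  (hV : forall t, 0 <= t <= T -> V (y t, yd t))
  (hu : forall t, 0 <= t <= T -> uy (y t) (yd t) = ustar (x t) (l t))
  (hEL : euler_lagrange_solution (reduced (control_lagrangian f C) uy) T y yd)
  (tc : R) :
  hamiltonian_conjugate_time (reduced (normal_ham f C) ustar) T x l tc <->
  lagrangian_conjugate_time (reduced (control_lagrangian f C) uy) T y yd tc.
Proof.
have Cg := class_C_common_part hf hC.
pose g := common_part f C; rewrite -/g in Cg.
have FH := normal_hamE f C; have FL := control_lagrangianE f C; rewrite -/g in FH FL.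
have cfst : continuous (fst : 'cV[R]_(n + n) * 'cV[R]_(n + n) -> _).
  by move=> z; exact: cvg_fst.
have csnd : continuous (snd : 'cV[R]_(n + n) * 'cV[R]_(n + n) -> _).
  by move=> z; exact: cvg_snd.
have cHp : continuous (@ham_p R n) by exact: continuous_usubmx_comp csnd.
have cHv : continuous (@ham_v R n) by exact: continuous_dsubmx_comp cfst.
have cLk : continuous (@lag_vk R n) by exact: continuous_dsubmx_comp csnd.
have cLq : continuous (@lag_vq R n) by exact: continuous_usubmx_comp csnd.
have cHs := @ham_state_continuous R n; have cLs := @lag_state_continuous R n.
pose base t := (ham_state (x t, l t), law ustar (x t, l t)).
(* A direction (q, v, kappa) is lifted to (x, l) with zero l_q component before the law is
   differentiated. *)
pose sens t (z : 'cV[R]_n * 'cV[R]_n * 'cV[R]_n) :=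
  'D_(col_mx z.1.1 z.1.2, col_mx 0 z.2) (law ustar) (x t, l t).
pose G t := reduced_form g (base t) (sens t).
have nondeg t : 0 <= t <= T ->
    forall s, s != 0 -> second_derive g (base t) (0, s) (0, s) < 0.
  move=> tT s s0; have := hlegendre t tT s s0.
  by rewrite (hess_control_pulled cHp cHv cHs Cg FH).
have sensP t : 0 <= t <= T ->
    forall z h, second_derive g (base t) (0, h) (z, sens t z) = 0.
  move=> tT [[zq zv] zk] h.
  have E : ham_state (col_mx zq zv, col_mx 0 zk) = (zq, zv, zk).
    by rewrite ham_stateE !col_mxKu !col_mxKd.
  rewrite -[X in (X, sens _ _)]E.
  exact: (law_sens cHp cHv cHs Cg FH hustar _ _ (hU t tT)).
have H2 t : 0 <= t <= T -> forall e e',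
    second_derive (fun z => reduced (normal_ham f C) ustar z.1 z.2) (x t, l t) e e' =
    dotp (usubmx e.2) (dsubmx e'.1) + dotp (usubmx e'.2) (dsubmx e.1)
    + G t (ham_state e) (ham_state e').
  move=> tT e e'.
  rewrite (second_derive_reduced_pulled cHp cHv cHs Cg FH hustar _ _ (hU t tT)).
  (* The direction [e'] may have an l_q component, which the lift in [sens] sets to zero; uniqueness
     of the sensitivity makes the two derivatives agree. *)
  rewrite (sens_unique Cg (nondeg t tT) (sensP t tT)
    (fun h => law_sens cHp cHv cHs Cg FH hustar e' h (hU t tT))).
  by [].
(* Both flows differentiate the same curve q: its velocity is the upper block of [yd] on one side
   and, since l_q occurs only in l_q^T v, it is v on the other. *)
have dq t : 0 <= t <= T -> usubmx (yd t) = dsubmx (x t).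
  move=> tT; have [/deriv_on_usubmx dy _] := hEL t tT.
  have [/deriv_on_usubmx dx _] := hext t tT.
  have {dy} := deriv_on_ext tT _ dy; move=> /(_ (fun s => usubmx (x s))) dy.
  have {}dy := dy (fun s sT => etrans (congr1 usubmx (hy s sT)) (col_mxKu _ _)).
  rewrite (deriv_on_unique hT tT dy dx); apply/colP => i; rewrite !mxE.
  rewrite (derive_slice2 (fun z => reduced (normal_ham f C) ustar z.1 z.2)).
  have D1 e : 'D_e (fun z => reduced (normal_ham f C) ustar z.1 z.2) (x t, l t) =
      dotp (usubmx e.2) (dsubmx (x t)) + dotp (usubmx (l t)) (dsubmx e.1)
      + 'D_(ham_state e, 0) g (base t).
    exact: (derive_reduced_pulled cHp cHv cHs Cg FH hustar e (hU t tT)).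
  rewrite D1 ham_stateE delta_lshift col_mxKu col_mxKd !linear0 derive0 addr0.
  rewrite dotp0r addr0 dotpE (bigD1 i)//= !mxE !eqxx mul1r big1 ?addr0// => j ji.
  by rewrite !mxE (negPf ji) mul0r.
(* The second derivatives of [g] are thus taken at one and the same point on both sides, control
   included. *)
have baseL t : 0 <= t <= T ->
    (lag_state (y t, yd t), law uy (y t, yd t)) = base t.
  move=> tT; rewrite /base /law /= hu// lag_stateE ham_stateE dq//.
  by rewrite hy// col_mxKu col_mxKd.
have L2 t : 0 <= t <= T -> forall e e',
    second_derive (fun z => reduced (control_lagrangian f C) uy z.1 z.2)
      (y t, yd t) e e' =
    dotp (dsubmx e.2) (usubmx e'.2) + dotp (dsubmx e'.2) (usubmx e.2)
    + G t (lag_state e) (lag_state e').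
  move=> tT e e'.
  (* The law [uy] solves the sensitivity equation at the same base point as [ustar], so its
     derivative is again given by [sens], and the same form [G t] appears in both Hessians. *)
  have E h : second_derive g (base t) (0, h)
      (lag_state e', 'D_e' (law uy) (y t, yd t)) = 0.
    rewrite -(baseL t tT).
    exact: (law_sens cLk cLq cLs Cg FL huy e' h (hV t tT)).
  rewrite /G /reduced_form -(sens_unique Cg (nondeg t tT) (sensP t tT) E).
  rewrite -(baseL t tT).
  exact: (second_derive_reduced_pulled cLk cLq cLs Cg FL huy e e' (hV t tT)).
have GC t : 0 <= t <= T -> forall z z', G t z z' = G t z' z.
  by move=> tT z z'; exact: reduced_formC Cg (sensP t tT) z z'.
have G0 t z : G t 0 z = 0 by exact: reduced_form0l.
have Hxl t (tT : 0 <= t <= T) := ham_mixed (GC t tT) (G0 t) (H2 t tT).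
have Hll t (tT : 0 <= t <= T) := ham_hess_l (GC t tT) (G0 t) (H2 t tT).
have Hxx t (tT : 0 <= t <= T) := ham_hess_x (GC t tT) (H2 t tT).
have Lyd t (tT : 0 <= t <= T) := lag_mixed (GC t tT) (G0 t) (L2 t tT).
have Ldd t (tT : 0 <= t <= T) := lag_hess_yd (GC t tT) (G0 t) (L2 t tT).
have Lyy t (tT : 0 <= t <= T) := lag_hess_y (GC t tT) (L2 t tT).
split; first exact: (conjugate_time_ham_lag hT Hxl Hll Hxx Lyd Ldd Lyy).
exact: (conjugate_time_lag_ham Hxl Hll Hxx Lyd Ldd Lyy).
Qed.
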